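(* Let $n \geqslant 3$ be an integer and let $\mathcal{G}$ be a real solvable Lie algebra of dimension $n$ whose first derived ideal $\mathcal{G}^1 = [\mathcal{G},\mathcal{G}]$ is $(n-1)$-dimensional. (i) If $\mathcal{G}^1$ is commutative, then $\mathcal{G}$ is an $MD(n,n-1)$-algebra; moreover, $\mathcal{G}$ is indecomposable. (ii) If $n > 4$ and $\mathcal{G}$ is an $MD(n,n-1)$-algebra, then $\mathcal{G}^1$ is commutative.
   Context: For a Lie group $G$ with Lie algebra $\mathcal{G}$, the coadjoint representation $K$ of $G$ in the dual space $\mathcal{G}^*$ is $\langle K_{(g)}F, X\rangle = \langle F, \mathrm{Ad}(g^{-1})X\rangle$, and its orbits are called $K$-orbits. The $K$-orbit $\Omega_F$ of $F\in\mathcal{G}^*$ has dimension equal to the rank of the skew-symmetric bilinear form $B_F(X,Y)=\langle F,[X,Y]\rangle$ on $\mathcal{G}$. An $MD$-group is a finite-dimensional real solvable Lie group (taken connected and simply connected) each of whose $K$-orbits has dimension either zero or the maximal dimension among all $K$-orbits of the group. An $MD$-algebra is the Lie algebra of an $MD$-group (equivalently, a finite-dimensional real solvable Lie algebra for which every $B_F$ has rank $0$ or rank $\max_{F'}\operatorname{rank}B_{F'}$). For $0<m<n$, an $MD(n,m)$-algebra is an $n$-dimensional $MD$-algebra whose first derived ideal is $m$-dimensional. A Lie algebra is decomposable if it is the direct sum (as a Lie algebra) of two non-trivial proper Lie subalgebras, and indecomposable otherwise. *)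

(* Defs.v *)
From HB Require Import structures.
From mathcomp Require Import all_boot all_order all_algebra.

Set Implicit Arguments.
Unset Strict Implicit.
Unset Printing Implicit Defensive.

Import GRing.Theory.
Local Open Scope ring_scope.

HB.mixin Record Vector_isLieAlgebra (F : fieldType) L of Vector F L := {
  lie : L -> L -> L;
  lie_is_bilinear : bilinear_for *:%R *:%R lie;
  liexx : forall x, lie x x = 0;
  lie_jacobi : forall x y z,
    lie x (lie y z) + lie y (lie z x) + lie z (lie x y) = 0
}.

#[short(type="lieAlgType")]
HB.structure Definition LieAlgebra (F : fieldType) :=
  { L of Vector F L & Vector_isLieAlgebra F L }.

HB.instance Definition _ (F : fieldType) (L : lieAlgType F) :=
  bilinear_isBilinear.Build F L L L *:%R *:%R (@lie F L) (@lie_is_bilinear F L).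

Section LieAlgebra.

Variables (F : fieldType) (L : lieAlgType F).
Implicit Types U V W : {vspace L}.

Definition lie_prodv U V : {vspace L} :=
  <<[seq lie u v | u <- vbasis U, v <- vbasis V]>>%VS.

(* [lie_prodv U V] is the span of all brackets of an element of [U] with an
   element of [V], not only of those of basis vectors. *)
Lemma lie_prodvP U V W :
  reflect (forall u v, u \in U -> v \in V -> lie u v \in W)
          (lie_prodv U V <= W)%VS.
Proof.
apply: (iffP span_subvP) => [sW u v uU vV|sW _ /allpairsP[[u v] /= [uU vV ->]]].
  rewrite (coord_vbasis uU) (coord_vbasis vV) linear_sumlz /= rpred_sum // => i _.
  rewrite linear_sumr /= rpred_sum // => j _.
  rewrite linearZl_LR linearZr_LR /= !rpredZ //.
  by apply: sW; apply: allpairs_f; rewrite mem_nth ?size_tuple.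
by apply: sW; apply: vbasis_mem.
Qed.

Definition lie_derived (k : nat) : {vspace L} :=
  iter k (fun U => lie_prodv U U) fullv.

Definition lie_solvable : Prop := exists k, lie_derived k = 0%VS.

Definition lie_commutative U : Prop :=
  forall x y, x \in U -> y \in U -> lie x y = 0.

Definition lie_subalgebra U : Prop :=
  forall x y, x \in U -> y \in U -> lie x y \in U.

Definition lie_decomposable : Prop :=
  exists U V,
    [/\ lie_subalgebra U /\ lie_subalgebra V,
        (U != 0%VS) && (U != fullv),
        (V != 0%VS) && (V != fullv),
        (U + V)%VS = fullv /\ (U :&: V)%VS = 0%VS
      & forall x y, x \in U -> y \in V -> lie x y = 0].

Definition lie_indecomposable : Prop := ~ lie_decomposable.

(* The form B_f(x, y) = <f, [x, y]>. *)
Definition coad_form (f : 'Hom(L, F^o)) (x y : L) : F := f (lie x y).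

(* Rank of B_f, as the rank of its Gram matrix in a basis of [L]. For real [L]
   it is the dimension of the coadjoint orbit of [f] under the connected simply
   connected Lie group with Lie algebra [L]. *)
Definition orbit_dim (f : 'Hom(L, F^o)) : nat :=
  \rank (\matrix_(i < \dim {:L}, j < \dim {:L})
           coad_form f (vbasis {:L})`_i (vbasis {:L})`_j).

Definition MD_algebra : Prop :=
  lie_solvable /\
  forall f, orbit_dim f = 0%N \/ forall f', (orbit_dim f' <= orbit_dim f)%N.

Definition MD_nm_algebra (n m : nat) : Prop :=
  [/\ (0 < m < n)%N, MD_algebra, \dim {:L} = n & \dim (lie_derived 1) = m].

End LieAlgebra.

Arguments lie_solvable {F} L.
Arguments lie_derived {F} L k.
Arguments lie_decomposable {F} L.
Arguments lie_indecomposable {F} L.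
Arguments MD_algebra {F} L.
Arguments MD_nm_algebra {F} L n m.

(* Main.v *)
(* (i) If N = [G, G] is commutative and G = <x> + N, then ad x maps N onto N,
   hence is injective on N, which excludes a direct decomposition. Every B_f
   vanishes on N x N and N is a hyperplane, so B_f has rank 0 or 2.

   (ii) A form f that kills [N, N] but not N has B_f of rank 2, so the MD
   property bounds the rank of every B_f by 2, i.e. every B_f satisfies the
   Pluecker relation. Fix f with B_f(p, q) != 0 and let K be the radical of B_f,
   of codimension 2. Polarizing the relation between f and an arbitrary g gives
   [K, K] = 0, and then [p, z][q, t] = [p, t][q, z] in the symmetric algebra for
   z, t in K. Unless dim N <= 3, this forces some nonzero combination of p and q
   to commute with K, which yields a commutative hyperplane U. The Jacobi
   identity then gives N <= U. *)
From HB Require Import structures.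
Require Import Defs.
From mathcomp Require Import all_boot all_order all_algebra.
From mathcomp Require Import ring reals.

Set Implicit Arguments.
Unset Strict Implicit.
Unset Printing Implicit Defensive.

Import GRing.Theory.
Local Open Scope ring_scope.

(** * Separating functionals, and products of vectors as functions on the dual *)

Section Dual.

Variables (F : fieldType) (V : vectType F).
Implicit Types (U : {vspace V}) (g : 'Hom(V, F^o)).

Lemma dualZ g k v : g (k *: v) = k * (g v : F).
Proof. by rewrite linearZ. Qed.

Lemma sep_vspace U b : b \notin U ->
  exists2 g : 'Hom(V, F^o), forall a, a \in U -> g a = 0 & g b != 0.
Proof.
(* [r] projects along [U] and kills exactly [U], so some coordinate of [r b] is nonzero; that
   coordinate composed with [r] is the functional. *)
move=> bU; pose r : 'End(V) := \1%VF - projv U.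
have rE v : r v = v - projv U v by rewrite add_lfunE opp_lfunE id_lfunE.
have rb0 : r b != 0.
  rewrite rE subr_eq0; apply: contraNneq bU => ->.
  exact: memv_proj.
have [i ci] : exists i, coord (vbasis {:V}) i (r b) != 0.
  apply/existsP; apply: contraNT rb0 => /existsPn c0.
  rewrite (coord_vbasis (memvf (r b))) big1 // => i _.
  by move/negPn/eqP: (c0 i) => ->; rewrite scale0r.
have gE v : linfun (coord (vbasis {:V}) i : V -> F^o) (r v)
            = coord (vbasis {:V}) i (r v) by rewrite lfunE.
exists (linfun (coord (vbasis {:V}) i : V -> F^o) \o r)%VF => [a aU|].
  by rewrite comp_lfunE rE projv_id // subrr linear0.
by rewrite comp_lfunE gE.
Qed.

(** If neither of the functionals separating [b] and [c] serves for both, each vanishes at the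
    other's vector and their sum serves. This works over any field. *)
Lemma sep_vspace2 U b c : b \notin U -> c \notin U ->
  exists g : 'Hom(V, F^o),
    [/\ forall a, a \in U -> g a = 0, g b != 0 & g c != 0].
Proof.
move=> /sep_vspace[g gU gb] /sep_vspace[h hU hc].
have [gc|gc] := eqVneq (g c) 0; last by exists g.
have [hb|hb] := eqVneq (h b) 0; last by exists h.
exists (g + h); split=> [a aU||].
- by rewrite add_lfunE gU // hU // addr0.
- by rewrite add_lfunE hb addr0.
- by rewrite add_lfunE gc add0r.
Qed.

Lemma dual_inj v : (forall g, g v = 0) -> v = 0.
Proof.
move=> v0; apply/eqP; rewrite -memv0; apply/negPn/negP => /sep_vspace[g _].
by rewrite v0 eqxx.
Qed.

(* Degree-one shadows of unique factorization in the symmetric algebra of V,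
   whose elements are read as polynomial functions on the dual. *)
Lemma dual_mul_eq0 a b : (forall g, (g a : F) * g b = 0) -> a = 0 \/ b = 0.
Proof.
move=> ab; have [->|a0] := eqVneq a 0; first by left.
have [->|b0] := eqVneq b 0; first by right.
have [||g [_ ga gb]] := @sep_vspace2 0%VS a b; rewrite ?memv0 //.
by move/eqP: (ab g); rewrite mulf_eq0 (negPf ga) (negPf gb).
Qed.

Lemma dual_mul_eq a b c d :
    a != 0 -> c \notin <[a]>%VS ->
    (forall g, (g a : F) * g d = (g b : F) * g c) ->
  exists k, b = k *: a /\ d = k *: c.
Proof.
move=> a0 ca abcd; have [|ba] := boolP (b \in <[a]>%VS); last first.
  (* A functional killing [a] but neither [b] nor [c] contradicts the identity. *)
  have [g [ga gb gc]] := sep_vspace2 ba ca.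
  move/eqP: (abcd g); rewrite ga ?memv_line // mul0r eq_sym mulf_eq0.
  by rewrite (negPf gb) (negPf gc).
case/vlineP => k bE; exists k; split=> //.
case: (@dual_mul_eq0 a (d - k *: c)) => [g|/eqP|/eqP].
- by rewrite linearB /= mulrBr abcd bE !dualZ; ring.
- by rewrite (negPf a0).
- by rewrite subr_eq0 => /eqP.
Qed.

End Dual.

Section LieAlgebra.

Variables (F : fieldType) (L : lieAlgType F).
Implicit Types (f g : 'Hom(L, F^o)) (x y z t u v : L) (U V W : {vspace L}).

(** * Linearity of ad x and calculus of the forms B_f *)

HB.instance Definition _ x :=
  GRing.isLinear.Build F L L *:%R (lie x) (linearPr (@lie F L) x).

Lemma lieC x y : lie x y = - lie y x.
Proof.
apply/eqP; rewrite -addr_eq0; apply/eqP.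
have := liexx (x + y); rewrite linearDl !linearDr /= !liexx.
by rewrite add0r addr0.
Qed.

Lemma coad_formC f x y : coad_form f x y = - coad_form f y x.
Proof. by rewrite /coad_form lieC linearN. Qed.

Lemma coad_formxx f x : coad_form f x x = 0.
Proof. by rewrite /coad_form liexx linear0. Qed.

Lemma coad_formDl f x y z :
  coad_form f (x + y) z = coad_form f x z + coad_form f y z.
Proof. by rewrite /coad_form linearDl linearD. Qed.

Lemma coad_formZl f a x y : coad_form f (a *: x) y = a * coad_form f x y.
Proof. by rewrite /coad_form linearZl_LR linearZ. Qed.

Lemma coad_formDr f x y z :
  coad_form f x (y + z) = coad_form f x y + coad_form f x z.
Proof. by rewrite /coad_form linearDr linearD. Qed.

Lemma coad_formZr f a x y : coad_form f x (a *: y) = a * coad_form f x y.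
Proof. by rewrite /coad_form linearZr_LR linearZ. Qed.

Lemma coad_form_addf f g x y :
  coad_form (f + g) x y = coad_form f x y + coad_form g x y.
Proof. by rewrite /coad_form add_lfunE. Qed.

Definition coad_formE :=
  (coad_formDl, coad_formZl, coad_formDr, coad_formZr, coad_formxx).

(** * Bounds on the rank of B_f *)

Lemma gram_rank_le f k l (u : 'I_k -> L) (v : 'I_l -> L) :
  (\rank (\matrix_(i, j) coad_form f (u i) (v j)) <= orbit_dim f)%N.
Proof.
pose e := vbasis {:L}; rewrite /orbit_dim; set M := (X in (_ <= \rank X)%N).
pose A := \matrix_(i < k, j < \dim {:L}) coord e j (u i).
pose B := \matrix_(j < \dim {:L}, i < l) coord e j (v i).
suff -> : \matrix_(i, j) coad_form f (u i) (v j) = A *m M *m B.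
  by rewrite (leq_trans (mxrankM_maxl _ _)) // mxrankM_maxr.
apply/matrixP => i j; rewrite !mxE /coad_form.
rewrite {1}(coord_vbasis (memvf (v j))) linear_sumr linear_sum /=.
apply: eq_bigr => q _; rewrite !mxE mulr_suml.
rewrite {1}(coord_vbasis (memvf (u i))) linear_sumlz linear_sum /=.
apply: eq_bigr => p _; rewrite !mxE linearZl_LR linearZr_LR /= !linearZ /=.
by rewrite /coad_form /GRing.scale /= mulrAC mulrA.
Qed.

(** A triangular matrix with nonzero diagonal is invertible. The lower bounds on the rank that
    follow come from suitable lists [s] and [r]. *)
Lemma trig_gram_le f (s r : seq L) :
    (forall i j, (i < j < size s)%N -> coad_form f s`_i r`_j = 0) ->
    (forall i, (i < size s)%N -> coad_form f s`_i r`_i != 0) ->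
  (size s <= orbit_dim f)%N.
Proof.
move=> s0 sN; set k := size s in s0 sN *.
pose A := \matrix_(i < k, j < k) coad_form f s`_i r`_j.
have tA : is_trig_mx A.
  by apply/is_trig_mxP => i j ij; rewrite mxE s0 // ij /=.
have uA : A \in unitmx.
  rewrite unitmxE det_trig // unitfE; apply/prodf_neq0 => i _.
  by rewrite mxE sN.
by rewrite -(mxrank_unit uA); apply: gram_rank_le.
Qed.

Lemma orbit_dim_eq0 f : orbit_dim f = 0%N -> forall x y, f (lie x y) = 0.
Proof.
move=> f0 x y; apply/eqP; apply: contraT => fxy.
have: (1 <= orbit_dim f)%N.
  apply: (@trig_gram_le f [:: x] [:: y]) => [i [|j]|[|i]] //=.
  by rewrite andbC.
by rewrite f0.
Qed.

Lemma orbit_dim_ge2 f : (0 < orbit_dim f)%N -> (2 <= orbit_dim f)%N.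
Proof.
rewrite {1}/orbit_dim lt0n mxrank_eq0; set M := (X in X != 0) => M0.
have [[i j] /=] : exists ij, M ij.1 ij.2 != 0.
  apply/existsP; apply: contraNT M0 => /existsPn M0.
  by apply/eqP/matrixP => i j; have /negPn/eqP -> := M0 (i, j); rewrite mxE.
rewrite mxE; move: (_`_i) (_`_j) => x y fxy.
(* Reversing the pair on the right makes the alternating block diagonal. *)
apply: (@trig_gram_le f [:: x; y] [:: y; x]) => [{}i {}j|].
  by case: i j => [|[|i]] [|[|j]] //=; rewrite ?coad_formxx // andbC.
by case=> [|[|?]] //= _; rewrite coad_formC oppr_eq0.
Qed.

Lemma orbit_dim_gt2 f x y z t : f (lie x y) != 0 ->
    coad_form f x z = 0 -> coad_form f y z = 0 -> coad_form f t z != 0 ->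
  (2 < orbit_dim f)%N.
Proof.
move=> fxy xz yz tz.
apply: (@trig_gram_le f [:: x; y; t] [:: y; x; z]) => [i j|].
  case: i j => [|[|[|i]]] [|[|[|j]]] //=; rewrite ?coad_formxx //.
  by rewrite andbC.
by case=> [|[|[|i]]] //= _; rewrite coad_formC oppr_eq0.
Qed.

Lemma orbit_dim_le2 f x U : (<[x]> + U = fullv)%VS ->
    (forall u v, u \in U -> v \in U -> f (lie u v) = 0) ->
  (orbit_dim f <= 2)%N.
Proof.
move=> xU fU; pose e := vbasis {:L}.
have dec (i : 'I_(\dim {:L})) : {a : F | e`_i - a *: x \in U}.
  apply: sigW; have: e`_i \in (<[x]> + U)%VS by rewrite xU memvf.
  case/memv_addP => _ /vlineP[a ->] [u uU ->].
  by exists a; rewrite addrAC subrr add0r.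
pose a i := sval (dec i); pose u (i : 'I_(\dim {:L})) := e`_i - a i *: x.
have uU i : u i \in U := svalP (dec i).
have eE (i : 'I_(\dim {:L})) : e`_i = a i *: x + u i by rewrite addrC subrK.
clearbody u a; rewrite /orbit_dim -/e.
pose b i := coad_form f x (u i).
(* Since B_f vanishes on [U], only the pairings with [x] survive, and the matrix is a difference of
   two products of a column by a row. *)
have -> : \matrix_(i < \dim {:L}, j < \dim {:L}) coad_form f e`_i e`_j =
  (\col_i a i) *m (\row_j b j) + (- \col_i b i) *m (\row_j a j).
  apply/matrixP => i j; rewrite !mxE !big_ord1 !mxE eE (eE j) !coad_formE.
  have -> : coad_form f (u i) (u j) = 0 by apply: fU.
  by rewrite (coad_formC f (u i)) /b; ring.
apply: leq_trans (mxrank_add _ _) _; apply: (@leq_add _ _ 1 1).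
  by rewrite (leq_trans (mulmx_max_rank _ _)).
by rewrite (leq_trans (mulmx_max_rank _ _)).
Qed.

(** * The Pluecker relation for forms of rank at most 2 *)

Lemma plucker f x y z t : (orbit_dim f <= 2)%N ->
  coad_form f x y * coad_form f z t - coad_form f x z * coad_form f y t
    + coad_form f x t * coad_form f y z = 0.
Proof.
move=> f2.
have main a b c d : coad_form f a b != 0 ->
    coad_form f a b * coad_form f c d - coad_form f a c * coad_form f b d
      + coad_form f a d * coad_form f b c = 0.
  move=> fab.
  (* A multiple of [c] corrected to be orthogonal to [a] and [b]. By the rank bound it is orthogonal
     to every [d], which is the relation itself. *)
  pose c' := coad_form f a b *: c
    + (coad_form f b c *: a + (- coad_form f a c) *: b).
  have ac' : coad_form f a c' = 0 by rewrite /c' !coad_formE; ring.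
  have bc' : coad_form f b c' = 0.
    by rewrite /c' !coad_formE (coad_formC f b a); ring.
  suff/eqP: coad_form f d c' = 0.
    rewrite coad_formC oppr_eq0 /c' !coad_formE => /eqP <-; ring.
  apply/eqP; apply: contraLR f2 => dc'.
  by rewrite -ltnNge (orbit_dim_gt2 fab ac' bc' dc').
(* Some pairing of [x] is nonzero and [main] applies after a permutation, or all three terms
   vanish. *)
have [xy|/main//] := eqVneq (coad_form f x y) 0.
have [xz|/main xz] := eqVneq (coad_form f x z) 0; last first.
  by rewrite -[RHS]oppr0 -(xz y t) (coad_formC f z y); ring.
have [xt|/main xt] := eqVneq (coad_form f x t) 0; last first.
  by rewrite -(xt y z) (coad_formC f t z) (coad_formC f t y); ring.
by rewrite xy xz xt; ring.
Qed.

Lemma plucker_polar f g x y z t :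
    (orbit_dim f <= 2)%N -> (orbit_dim g <= 2)%N ->
    (orbit_dim (f + g)%R <= 2)%N ->
  coad_form f x y * coad_form g z t + coad_form g x y * coad_form f z t
    - coad_form f x z * coad_form g y t - coad_form g x z * coad_form f y t
    + coad_form f x t * coad_form g y z + coad_form g x t * coad_form f y z = 0.
Proof.
pose P h := coad_form h x y * coad_form h z t
  - coad_form h x z * coad_form h y t + coad_form h x t * coad_form h y z.
move=> f2 g2 fg2; transitivity (P (f + g) - P f - P g).
  by rewrite /P !coad_form_addf; ring.
by rewrite /P !plucker // !subr0.
Qed.

(** * Commutative hyperplanes *)

Lemma mem_addv_line x U v :
  reflect (exists a u, u \in U /\ v = a *: x + u) (v \in <[x]> + U)%VS.
Proof.
apply: (iffP memv_addP) => [[_ /vlineP[a ->] [u uU ->]]|[a [u [uU ->]]]].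
  by exists a, u.
by exists (a *: x); rewrite ?memvZ ?memv_line //; exists u.
Qed.

(** Every bracket comes from ad x on [U]: [a x + u, b x + v] = [x, a v - b u]. *)
Lemma lie_derived1_hyperplane x U W : (<[x]> + U = fullv)%VS ->
    lie_commutative U -> (forall u, u \in U -> lie x u \in W) ->
  (lie_derived L 1 <= W)%VS.
Proof.
move=> xU cU xW; apply/lie_prodvP => y z _ _.
have: y \in (<[x]> + U)%VS by rewrite xU memvf.
case/mem_addv_line=> a [u [uU ->]].
have: z \in (<[x]> + U)%VS by rewrite xU memvf.
case/mem_addv_line=> b [v [vU ->]].
rewrite !(linearDl, linearDr) /= !(linearZl_LR, linearZr_LR) /= liexx.
rewrite (cU u v) // (lieC u x) !scaler0 add0r addr0 memvD ?memvZ ?memvN //; exact: xW.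
Qed.

(** Were some [x, u] outside [U], every [x, v] would be a multiple of it, and the derived ideal
    would be at most a line. *)
Lemma commutative_hyperplane x U : (<[x]> + U = fullv)%VS ->
    lie_commutative U -> (1 < \dim (lie_derived L 1))%N ->
  lie_commutative (lie_derived L 1).
Proof.
move=> xU cU d1; suff NU : (lie_derived L 1 <= U)%VS.
  by move=> y z /(subvP NU) yU /(subvP NU) zU; apply: cU.
have dec y : exists a u, u \in U /\ y = a *: x + u.
  by apply/mem_addv_line; rewrite xU memvf.
apply: (lie_derived1_hyperplane xU cU) => u uU; apply: contraLR d1 => xuU.
suff NU : (lie_derived L 1 <= <[lie x u]>)%VS.
  by rewrite -leqNgt (leq_trans (dimvS NU)) // dim_vline leq_b1.
have [a [w [wU xuE]]] := dec (lie x u).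
have a0 : a != 0 by apply: contraNneq xuU => a0; rewrite xuE a0 scale0r add0r.
apply: (lie_derived1_hyperplane xU cU) => v vU.
have [b [w' [w'U xvE]]] := dec (lie x v).
suff /(canRL (scalerK a0)) -> : a *: lie x v = b *: lie x u.
  by rewrite !memvZ ?memv_line.
(* As [u, v] = 0, this reads [u, [x, v]] = [v, [x, u]], where only the [x] components contribute. *)
have := lie_jacobi x u v.
rewrite (lieC v x) (cU u v) // linear0r add0r [in lie v _]xuE [in lie u _]xvE.
rewrite linearNr !linearDr /= !linearZr_LR /= (cU u w') // (cU v w) // !addr0.
by rewrite (lieC u x) (lieC v x) !scalerN opprK => /eqP; rewrite subr_eq0 => /eqP.
Qed.

Lemma abelian_hyperplane : (forall f, orbit_dim f <= 2)%N ->
    (3 < \dim (lie_derived L 1))%N ->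
  exists x U, (<[x]> + U = fullv)%VS /\ lie_commutative U.
Proof.
move=> rk2 d3.
have [p [q pq0]] : exists p q : L, lie p q != 0.
  suff: has (fun w => w != 0) [seq lie u v | u <- vbasis {:L}, v <- vbasis {:L}].
    by case/hasP=> w /allpairsP[[p q] /= [_ _ ->]] pq0; exists p, q.
  apply: contraLR d3 => /hasPn w0; rewrite -leqNgt.
  suff -> : lie_derived L 1 = 0%VS by rewrite dimv0.
  apply/eqP; rewrite -subv0; apply/span_subvP => w /w0.
  by rewrite negbK => /eqP ->; rewrite mem0v.
have [f _ fpq] : exists2 f : 'Hom(L, F^o), (forall a, a \in 0%VS -> f a = 0)
    & coad_form f p q != 0 by apply: sep_vspace; rewrite memv0.
(* The orthogonal of [p] and [q] for B_f; rank 2 makes it the whole radical. *)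
pose K := (lker (f \o linfun (lie p)) :&: lker (f \o linfun (lie q)))%VS.
have KP z : z \in K -> coad_form f p z = 0 /\ coad_form f q z = 0.
  by rewrite memv_cap !memv_ker !comp_lfunE !lfunE => /andP[/eqP ? /eqP ?].
have dec v : exists a b k, k \in K /\ v = a *: p + (b *: q + k).
  (* The coefficients of [p] and [q] are those that make the remainder orthogonal to both. *)
  pose c := coad_form f p q.
  exists (- (coad_form f q v / c)), (coad_form f p v / c).
  exists (v + ((coad_form f q v / c) *: p + (- (coad_form f p v / c)) *: q)).
  split; last first.
    by rewrite !scaleNr (addrC (_ *: q)) -(addrA v) subrK [- _ + _]addrC addrK.
  rewrite memv_cap !memv_ker !comp_lfunE !lfunE -!/(coad_form f _ _).
  rewrite !coad_formE (coad_formC f q p) -/c.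
  by rewrite !mulr0 add0r addr0 mulNr mulrN !divfK // !subrr eqxx.
have KK z t : z \in K -> t \in K -> lie z t = 0.
  move=> /KP[pz qz] /KP[pt qt]; apply: dual_inj => g.
  have fzt : coad_form f z t = 0.
    have /eqP := plucker p q z t (rk2 f).
    by rewrite pz pt !mul0r subr0 addr0 mulf_eq0 (negPf fpq) => /eqP.
  (* Every term except B_f(p, q) B_g(z, t) has a zero factor. *)
  have /eqP := plucker_polar p q z t (rk2 f) (rk2 g) (rk2 (f + g)).
  rewrite fzt pz pt qz qt !(mul0r, mulr0) !subr0 !addr0 mulf_eq0 (negPf fpq).
  by move/eqP.
have pq_swap z t g : z \in K -> t \in K ->
    coad_form g p z * coad_form g q t = coad_form g p t * coad_form g q z.
  move=> zK tK; have /eqP := plucker p q z t (rk2 g).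
  rewrite {2}/coad_form KK // linear0 mulr0 sub0r addrC subr_eq0.
  by move/eqP.
(* The commutative hyperplane will be the span of [q'] and [K]. *)
suff [p' [q' [pqK qK]]] : exists p' q', (<[p']> + (<[q']> + K) = fullv)%VS /\
    forall k, k \in K -> lie q' k = 0.
  exists p', (<[q']> + K)%VS; split=> // y z.
  case/mem_addv_line=> a [k [kK ->]]; case/mem_addv_line=> b [l [lK ->]].
  rewrite !(linearDl, linearDr) /= !(linearZl_LR, linearZr_LR) /= liexx.
  by rewrite (lieC k) !qK // KK // !(scaler0, oppr0, addr0).
have span3 p' q' :
    (forall v, exists a b k, k \in K /\ v = a *: p' + (b *: q' + k)) ->
    (<[p']> + (<[q']> + K) = fullv)%VS.
  move=> dec'; apply/eqP; rewrite eqEsubv subvf; apply/subvP => v _.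
  have [a [b [k [kK ->]]]] := dec' v.
  by rewrite !memv_add // memvZ ?memv_line.
have [pK|/subvPn[z zK]] := boolP (K <= lker (linfun (lie p)))%VS.
  exists q, p; split=> [|k /(subvP pK)]; last by rewrite memv_ker lfunE => /eqP.
  apply: span3 => v; have [a [b [k [kK ->]]]] := dec v.
  by exists b, a, k; rewrite addrCA.
rewrite memv_ker lfunE /= => pz0.
(* If [q, z] = m [p, z], then [pq_swap] says that the product of [p, z] and [q - m p, t] is zero, so
   q - m p commutes with [K]. *)
have [/vlineP[m qzE]|qz] := boolP (lie q z \in <[lie p z]>%VS).
  exists p, (q - m *: p); split=> [|t tK].
    apply: span3 => v; have [a [b [k [kK ->]]]] := dec v.
    exists (a + b * m), b, k; split=> //.
    rewrite scalerDl scalerBr scalerA -[RHS]addrA.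
    by congr (_ + _); rewrite addrA [_ + (_ - _)]addrC subrK.
  have [g|/eqP|//] := @dual_mul_eq0 _ _ (lie p z) (lie (q - m *: p) t).
    rewrite -!/(coad_form g _ _) -scaleNr !coad_formE mulrDr pq_swap //.
    rewrite {2}/coad_form qzE dualZ -/(coad_form g p z); ring.
  by rewrite (negPf pz0).
(* Here [p, z] and [q, z] are independent, so [p, t] and [q, t] are multiples of them; three
   brackets then span the derived ideal, against [d3]. *)
have sub3 : (lie_derived L 1 <= <<[:: lie p q; lie p z; lie q z]>>)%VS.
  have Pk t : t \in K ->
      exists k, lie p t = k *: lie p z /\ lie q t = k *: lie q z.
    move=> tK; apply: dual_mul_eq => // g; exact: pq_swap.
  set W := <<_>>%VS.
  have [pqW pzW qzW] : [/\ lie p q \in W, lie p z \in W & lie q z \in W].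
    by split; apply: memv_span; rewrite !inE eqxx ?orbT.
  have PW t : t \in K -> lie p t \in W.
    by case/Pk=> k [-> _]; rewrite memvZ.
  have QW t : t \in K -> lie q t \in W.
    by case/Pk=> k [_ ->]; rewrite memvZ.
  apply/lie_prodvP => y w _ _.
  have [a [b [k [kK ->]]]] := dec y; have [c [d [l [lK ->]]]] := dec w.
  rewrite !(linearDl, linearDr) /= !(linearZl_LR, linearZr_LR) /= !liexx.
  rewrite (lieC q p) (lieC k p) (lieC k q) (KK k l) //.
  by do ![exact: pqW | rewrite memvN | apply: memvD | apply: memvZ
         | apply: PW | apply: QW | exact: mem0v].
by move: d3; rewrite ltnNge (leq_trans (dimvS sub3)) // dim_span.
Qed.

(** * Algebras whose derived ideal has codimension at most one *)

Lemma derived_complement x : (\dim {:L} <= (\dim (lie_derived L 1)).+1)%N ->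
  x \notin lie_derived L 1 -> (<[x]> + lie_derived L 1 = fullv)%VS.
Proof.
move=> dN xN; apply/eqP; rewrite eqEdim subvf (leq_trans dN) //.
rewrite ltnNge; apply: contra xN => le.
have /eqP -> : (lie_derived L 1 == <[x]> + lie_derived L 1)%VS.
  by rewrite eqEdim addvSr.
by rewrite (subvP (addvSl _ _)) ?memv_line.
Qed.

Lemma derived_complement_ex : (\dim {:L} <= (\dim (lie_derived L 1)).+1)%N ->
  exists x, (<[x]> + lie_derived L 1 = fullv)%VS.
Proof.
move=> dN; have [NL|/subvPn[x _ xN]] := boolP (fullv <= lie_derived L 1)%VS.
  exists 0; apply/eqP; rewrite eqEsubv subvf.
  exact: subv_trans NL (addvSr _ _).
by exists x; apply: derived_complement.
Qed.

Lemma lie_prodvS U V : (U <= V)%VS -> (lie_prodv U U <= lie_prodv V V)%VS.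
Proof.
move=> /subvP UV; apply/lie_prodvP => x y /UV xV /UV yV.
exact: (lie_prodvP _ _ _ (subvv _)).
Qed.

(** Otherwise every term of the derived series would contain the nonzero first one. *)
Lemma solvable_derived_neq : lie_solvable L -> (0 < \dim (lie_derived L 1))%N ->
  ~~ (lie_derived L 1 <= lie_derived L 2)%VS.
Proof.
move=> [k Lk0]; rewrite lt0n dimv_eq0; apply: contra => N12.
have Nk i : (lie_derived L 1 <= lie_derived L i)%VS.
  elim: i => [|i IHi]; first exact: subvf.
  exact: subv_trans N12 (lie_prodvS IHi).
by rewrite -subv0 -Lk0.
Qed.

Lemma orbit_dim_all_le2 : lie_solvable L -> (0 < \dim (lie_derived L 1))%N ->
    (\dim {:L} <= (\dim (lie_derived L 1)).+1)%N -> MD_algebra L ->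
  forall f, (orbit_dim f <= 2)%N.
Proof.
move=> solL N0 dN [_ MDL] h.
have /subvPn[b bN] := solvable_derived_neq solL N0.
case/sep_vspace=> f fN2 fb.
(* Rank 0 would make [f] vanish on all brackets, hence at [b]; so the rank of B_f is maximal. *)
have [f0|/(_ h) hf] := MDL f.
  case/eqP: fb; apply/eqP; rewrite -memv_ker; apply: (subvP _ _ bN).
  by apply/lie_prodvP => x y _ _; rewrite memv_ker orbit_dim_eq0.
apply: leq_trans hf _.
have [x xN] := derived_complement_ex dN; apply: orbit_dim_le2 xN _ => u v uN vN.
by apply: fN2; apply: (lie_prodvP _ _ _ (subvv _)).
Qed.

Lemma commutative_derived_MD : lie_commutative (lie_derived L 1) ->
    (\dim {:L} <= (\dim (lie_derived L 1)).+1)%N ->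
  lie_solvable L -> MD_algebra L.
Proof.
move=> cN dN solL; split=> // f.
have [|/orbit_dim_ge2 f2] := posnP (orbit_dim f); [by left|right=> g].
have [x xN] := derived_complement_ex dN.
apply: leq_trans f2; apply: orbit_dim_le2 xN _ => u v uN vN.
by rewrite cN // linear0.
Qed.

Lemma ad_injective_derived x u : lie_commutative (lie_derived L 1) ->
    (<[x]> + lie_derived L 1 = fullv)%VS -> u \in lie_derived L 1 ->
  lie x u = 0 -> u = 0.
Proof.
set N := lie_derived L 1 => cN xN uN xu0; pose f := linfun (lie x).
have /dimvS : (N <= f @: N)%VS.
  apply: (lie_derived1_hyperplane xN cN) => v vN.
  by apply/memv_imgP; exists v; rewrite ?lfunE.
(* Rank-nullity: an image at least as large as [N] leaves no kernel in [N]. *)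
rewrite -{1}(limg_ker_dim f N) -{2}[\dim (f @: N)]add0n leq_add2r leqn0 dimv_eq0.
move/eqP=> kerN; apply/eqP; rewrite -memv0 -kerN memv_cap uN memv_ker lfunE /=.
by rewrite xu0.
Qed.

Lemma commutative_derived_indecomposable : lie_commutative (lie_derived L 1) ->
    (\dim {:L} <= (\dim (lie_derived L 1)).+1)%N ->
    lie_derived L 1 != fullv ->
  lie_indecomposable L.
Proof.
set N := lie_derived L 1 => cN dN NL.
move=> [U [V [_ /andP[U0 _] /andP[V0 _] [UV UV0] cUV]]].
(* An element of [V'] is a x + w with [x, w] = 0, so w = 0 by injectivity of ad x on [N]; being a
   multiple of [x], it lies in both summands. *)
have trivial_summand U' V' x : (U' :&: V' = 0)%VS ->
    (forall y z, y \in U' -> z \in V' -> lie y z = 0) ->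
    x \in U' -> x \notin N -> V' == 0%VS.
  move=> U'V' cU'V' xU' xN; rewrite -subv0; apply/subvP => v vV'.
  have xNL := derived_complement dN xN.
  have: v \in (<[x]> + N)%VS by rewrite xNL memvf.
  case/mem_addv_line=> a [w [wN vE]].
  have w0 : w = 0.
    apply: (ad_injective_derived cN xNL wN).
    have := cU'V' x v xU' vV'.
    by rewrite vE linearDr linearZr_LR /= liexx scaler0 add0r.
  rewrite -U'V' memv_cap vV' andbT vE w0 addr0 memvZ //.
(* As [N] is proper, [U] and [V] cannot both lie in it. *)
have [UN|/subvPn[x xU xN]] := boolP (U <= N)%VS; last first.
  by rewrite (trivial_summand U V x) in V0.
have [VN|/subvPn[x xV xN]] := boolP (V <= N)%VS; last first.
  case/negP: U0; apply: (trivial_summand V U x) => //; first by rewrite capvC.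
  by move=> y z yV zU; rewrite lieC cUV // oppr0.
by case/negP: NL; rewrite eqEsubv subvf -UV subv_add UN.
Qed.

End LieAlgebra.

Theorem theorem4p3 (R : realType) (n : nat) (G : lieAlgType R) :
  (3 <= n)%N -> \dim {:G} = n -> lie_solvable G ->
  \dim (lie_derived G 1) = (n - 1)%N ->
  (lie_commutative (lie_derived G 1) ->
     MD_nm_algebra G n (n - 1)%N /\ lie_indecomposable G) /\
  ((4 < n)%N -> MD_nm_algebra G n (n - 1)%N ->
     lie_commutative (lie_derived G 1)).
Proof.
case: n => // n; rewrite subSS subn0 => n3 dG solG dN.
have dGN : (\dim {:G} <= (\dim (lie_derived G 1)).+1)%N by rewrite dG dN.
have N0 : (0 < \dim (lie_derived G 1))%N by rewrite dN; apply: ltnW.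
split=> [cN|n5 [_ MDG _ _]].
  split; first split=> //; first by rewrite ltnSn -dN N0.
    exact: commutative_derived_MD.
  apply: commutative_derived_indecomposable => //.
  by apply/eqP => NG; move: dN; rewrite NG dG => /eqP; rewrite gtn_eqF.
have rk2 := orbit_dim_all_le2 solG N0 dGN MDG.
(* The dimension of [G] is now [n.+1], so [n5] says that the derived ideal has dimension above 3. *)
have [|x [U [xU cU]]] := abelian_hyperplane rk2; first by rewrite dN.
by apply: commutative_hyperplane xU cU _; rewrite dN.
Qed.
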